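(* Let $H$ be a connected graph with $H\prec S_{10}$. Then $H\simeq S_{10}$.
   Context: Graphs are finite, undirected and loopless, but may contain parallel edges; $\simeq$ denotes isomorphism of (multi)graphs. For a vertex $u$ of a graph $G$, $\partial_G u$ denotes the set of edges of $G$ incident to $u$. An $H$-colouring of $G$ is a map $f:E(G)\to E(H)$ that is a proper edge-colouring (adjacent edges of $G$ receive distinct edges of $H$) such that for every $u\in V(G)$ there exists $v\in V(H)$ with $f(\partial_G u)=\partial_H v$. We write $H\prec G$ ($H$ colours $G$) if $G$ admits an $H$-colouring. $S_{10}$ (the Sylvester graph) is the cubic multigraph on the ten vertices $z$ and $u^i,v^i,w^i$ ($i\in\{1,2,3\}$) whose edges are, for each $i\in\{1,2,3\}$: two parallel edges between $v^i$ and $w^i$, one edge $u^iv^i$, one edge $u^iw^i$, and one edge $u^iz$. *)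

(* Defs.v *)
From HB Require Import structures.
From mathcomp Require Import all_boot.

Set Implicit Arguments.
Unset Strict Implicit.
Unset Printing Implicit Defensive.

(* Finite loopless multigraphs: edges are first-class, so several edges may
   have the same pair of ends. *)
Record multigraph := Multigraph {
  vertex : finType;
  edge : finType;
  ends : edge -> {set vertex};
  card_ends : forall e, #|ends e| = 2
}.

Definition incident_edges (G : multigraph) (u : vertex G) : {set edge G} :=
  [set e | u \in ends e].

Definition adjacent_vertices (G : multigraph) : rel (vertex G) :=
  fun u v => [exists e : edge G, ends e == [set u; v]].

(* The graph without vertices is not connected. *)
Definition connected (G : multigraph) : Prop :=
  0 < #|vertex G| /\ forall u v : vertex G, connect (@adjacent_vertices G) u v.

Definition isomorphic (G H : multigraph) : Prop :=
  exists (fV : vertex G -> vertex H) (fE : edge G -> edge H),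
    [/\ bijective fV, bijective fE & forall e, ends (fE e) = fV @: ends e].

Definition adjacent_edges (G : multigraph) : rel (edge G) :=
  fun e e' => (e != e') && (ends e :&: ends e' != set0).

Definition proper_edge_colouring (G : multigraph) (C : eqType)
    (f : edge G -> C) : Prop :=
  forall e e' : edge G, adjacent_edges e e' -> f e != f e'.

Definition H_colouring (H G : multigraph) (f : edge G -> edge H) : Prop :=
  proper_edge_colouring f /\
  forall u : vertex G, exists v : vertex H,
    f @: incident_edges u = incident_edges v.

Definition colours (H G : multigraph) : Prop :=
  exists f : edge G -> edge H, H_colouring f.

Inductive S10_vertex :=
  | S10_z
  | S10_u of 'I_3
  | S10_v of 'I_3
  | S10_w of 'I_3.

Definition S10_vertex_encode (x : S10_vertex) : unit + 'I_3 + 'I_3 + 'I_3 :=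
  match x with
  | S10_z => inl (inl (inl tt))
  | S10_u i => inl (inl (inr i))
  | S10_v i => inl (inr i)
  | S10_w i => inr i
  end.

Definition S10_vertex_decode (x : unit + 'I_3 + 'I_3 + 'I_3) : S10_vertex :=
  match x with
  | inl (inl (inl _)) => S10_z
  | inl (inl (inr i)) => S10_u i
  | inl (inr i) => S10_v i
  | inr i => S10_w i
  end.

Lemma S10_vertex_encodeK : cancel S10_vertex_encode S10_vertex_decode.
Proof. by case. Qed.

HB.instance Definition _ :=
  Finite.copy S10_vertex (can_type S10_vertex_encodeK).

(* [S10_vw b i], for the two values of [b], are the two parallel edges. *)
Inductive S10_edge :=
  | S10_vw of bool & 'I_3
  | S10_uv of 'I_3
  | S10_uw of 'I_3
  | S10_uz of 'I_3.

Definition S10_edge_encode (e : S10_edge) :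
    (bool * 'I_3) + 'I_3 + 'I_3 + 'I_3 :=
  match e with
  | S10_vw b i => inl (inl (inl (b, i)))
  | S10_uv i => inl (inl (inr i))
  | S10_uw i => inl (inr i)
  | S10_uz i => inr i
  end.

Definition S10_edge_decode (x : (bool * 'I_3) + 'I_3 + 'I_3 + 'I_3) :
    S10_edge :=
  match x with
  | inl (inl (inl (b, i))) => S10_vw b i
  | inl (inl (inr i)) => S10_uv i
  | inl (inr i) => S10_uw i
  | inr i => S10_uz i
  end.

Lemma S10_edge_encodeK : cancel S10_edge_encode S10_edge_decode.
Proof. by case. Qed.

HB.instance Definition _ :=
  Finite.copy S10_edge (can_type S10_edge_encodeK).

Definition S10_ends (e : S10_edge) : {set S10_vertex} :=
  match e with
  | S10_vw _ i => [set S10_v i; S10_w i]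
  | S10_uv i => [set S10_u i; S10_v i]
  | S10_uw i => [set S10_u i; S10_w i]
  | S10_uz i => [set S10_u i; S10_z]
  end.

Lemma S10_card_ends (e : S10_edge) : #|S10_ends e| = 2.
Proof. by case: e => *; rewrite /= cards2. Qed.

Definition S10 : multigraph := Multigraph S10_card_ends.

(* Main.v *)
(* Choose [g x] in H with star the image of the star of x.  The ends of an
   edge are then respected by [g] wherever [g] separates them, so it suffices
   that [g] is injective.  The block [T i] of the images of u^i, v^i, w^i is a
   triangle in H, and the image of the edge u^i z is the only edge of H leaving
   it: it is a bridge.  Every edge at [g z] is therefore a bridge and lies in no
   triangle, which keeps [g z] out of each block, and the connectivity of a
   triangle minus an edge makes different blocks disjoint. *)

Require Import Defs.
From mathcomp Require Import all_boot.

Set Implicit Arguments.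
Unset Strict Implicit.
Unset Printing Implicit Defensive.

(** * Ends of edges and symmetry of isomorphism *)

Section Multigraphs.

Variable G : multigraph.
Implicit Types (x y : vertex G) (e : edge G).

Lemma in_incident x e : (e \in incident_edges x) = (x \in ends e).
Proof. by rewrite inE. Qed.

Lemma ends_eq e x y : x \in ends e -> y \in ends e -> x != y ->
  ends e = [set x; y].
Proof.
move=> xe ye xy; apply/esym/eqP; rewrite eqEcard card_ends cards2 xy leqnn andbT.
by apply/subsetP => t; rewrite !inE => /orP[] /eqP ->.
Qed.

Lemma ends_witness e : exists x, x \in ends e.
Proof. by apply/set0Pn; rewrite -card_gt0 card_ends. Qed.

End Multigraphs.

(** A colouring of [S10] maps out of [S10], so the isomorphism is first built in the direction
    opposite to the one claimed. *)
Lemma isomorphic_sym G H : isomorphic G H -> isomorphic H G.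
Proof.
case=> fV [fE] [[gV fVK gVK] [gE fEK gEK] fends].
exists gV, gE; split; [by exists fV | by exists fE | move=> e].
by rewrite -{2}(gEK e) fends -imset_comp (eq_imset _ (fVK : gV \o fV =1 id)) imset_id.
Qed.

(** * Vertex maps induced by a colouring *)

Section VertexMap.

Variables (G H : multigraph) (f : edge G -> edge H) (g : vertex G -> vertex H).
Hypothesis fproper : proper_edge_colouring f.
Hypothesis gP : forall x, f @: incident_edges x = incident_edges (g x).

Lemma star_inj x e e' : x \in ends e -> x \in ends e' -> f e = f e' -> e = e'.
Proof.
move=> xe xe' /eqP fe; apply/eqP; apply: contraTT fe => ee'.
by apply: fproper; rewrite /adjacent_edges ee'; apply/set0Pn; exists x; rewrite inE xe.
Qed.

Lemma mem_ends_map x e : x \in ends e -> g x \in ends (f e).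
Proof.
by move=> xe; rewrite -in_incident -gP imset_f // in_incident.
Qed.

Lemma mem_ends_mapP x h : g x \in ends h -> exists2 e, x \in ends e & h = f e.
Proof.
by rewrite -in_incident -gP => /imsetP[e]; rewrite in_incident; exists e.
Qed.

Lemma vertex_map_inj_isomorphic :
  0 < #|vertex G| -> connected H -> injective g -> isomorphic G H.
Proof.
move=> /card_gt0P[x0 _] [_ Hconn] ginj.
have fends e : ends (f e) = g @: ends e.
  apply/esym/eqP; rewrite eqEcard card_imset // !card_ends leqnn andbT.
  by apply/subsetP => _ /imsetP[x xe ->]; apply: mem_ends_map.
have gsurj v : v \in codom g.
  have gcl : closed (@adjacent_vertices H) [pred v | v \in codom g].
    (* Every edge at [g x] is the image of an edge at [x], so its other end is also a value of [g];
       connectivity of [H] then gives surjectivity. *)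
    have half p q : adjacent_vertices p q -> p \in codom g -> q \in codom g.
      case/existsP=> h /eqP hpq /codomP[x px].
      have [|e _ he] := @mem_ends_mapP x h; first by rewrite hpq px !inE eqxx.
      have: q \in ends h by rewrite hpq !inE eqxx orbT.
      by rewrite he fends => /imsetP[y _ ->]; apply: codom_f.
    move=> p q pq; rewrite !inE; apply/idP/idP; apply: half => //.
    by move: pq; rewrite /adjacent_vertices setUC.
  by have := closed_connect gcl (Hconn (g x0) v); rewrite !inE codom_f => <-.
(* Properness only separates edges with a common end; injectivity of [g] shows that edges with equal
   images have one. *)
have finj : injective f.
  move=> e e' fe; have [x xe] := ends_witness e.
  apply: (@star_inj x) => //.
  by rewrite -(mem_imset _ _ ginj) -fends -fe fends mem_imset.
have fsurj h : h \in codom f.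
  have [v] := ends_witness h; have /codomP[x ->] := gsurj v.
  by case/mem_ends_mapP=> e _ ->; apply: codom_f.
have bij (A B : finType) (k : A -> B) :
    injective k -> (forall b, b \in codom k) -> bijective k.
  move=> kinj ksurj; apply: (inj_card_bij kinj).
  by rewrite -(card_codom kinj); apply/subset_leq_card/subsetP => b _; apply: ksurj.
by exists g, f; split; [exact: bij | exact: bij | exact: fends].
Qed.

End VertexMap.

(** * Images of the stars and edges of [S10] *)

Section Sylvester.

Variables (H : multigraph) (f : edge S10 -> edge H) (g : vertex S10 -> vertex H).
Hypothesis fproper : proper_edge_colouring f.
Hypothesis gP : forall x, f @: incident_edges x = incident_edges (g x).
Implicit Types (i j : 'I_3) (b : bool).

Lemma in_ends_S10 (x : vertex S10) (e : edge S10) : (x \in ends e) =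
  match e with
  | S10_vw _ i => (x == S10_v i) || (x == S10_w i)
  | S10_uv i => (x == S10_u i) || (x == S10_v i)
  | S10_uw i => (x == S10_u i) || (x == S10_w i)
  | S10_uz i => (x == S10_u i) || (x == S10_z)
  end.
Proof. by case: e => *; rewrite !inE. Qed.

Let z : vertex S10 := S10_z.
Let u i : vertex S10 := S10_u i.
Let v i : vertex S10 := S10_v i.
Let w i : vertex S10 := S10_w i.
Let vw b i : edge S10 := S10_vw b i.
Let uv i : edge S10 := S10_uv i.
Let uw i : edge S10 := S10_uw i.
Let uz i : edge S10 := S10_uz i.

Ltac inc := by rewrite in_ends_S10; apply/orP; first [left; exact: eqxx | right; exact: eqxx].

Lemma star_z h : g z \in ends h -> exists i, h = f (uz i).
Proof.
case/(mem_ends_mapP gP)=> e ze ->; move: ze; rewrite in_ends_S10.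
by case: e => [b i|i|i|i] // _; exists i.
Qed.

Lemma star_u i h : g (u i) \in ends h -> [\/ h = f (uv i), h = f (uw i) | h = f (uz i)].
Proof.
case/(mem_ends_mapP gP)=> e ue ->; move: ue; rewrite in_ends_S10.
by case: e => [b j|j|j|j] //; rewrite orbF => /eqP[<-]; [apply: Or31|apply: Or32|apply: Or33].
Qed.

Lemma star_v i h : g (v i) \in ends h -> (exists b, h = f (vw b i)) \/ h = f (uv i).
Proof.
case/(mem_ends_mapP gP)=> e ue ->; move: ue; rewrite in_ends_S10.
by case: e => [b j|j|j|j] //; rewrite ?orbF => /eqP[<-]; [left; exists b|right].
Qed.

Lemma star_w i h : g (w i) \in ends h -> (exists b, h = f (vw b i)) \/ h = f (uw i).
Proof.
case/(mem_ends_mapP gP)=> e ue ->; move: ue; rewrite in_ends_S10.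
by case: e => [b j|j|j|j] //; rewrite ?orbF => /eqP[<-]; [left; exists b|right].
Qed.

Lemma uv_uw i : f (uv i) <> f (uw i).
Proof. by move/(@star_inj _ _ _ fproper (u i)) => K; have: uv i = uw i by apply: K; inc. Qed.

Lemma uv_uz i : f (uv i) <> f (uz i).
Proof. by move/(@star_inj _ _ _ fproper (u i)) => K; have: uv i = uz i by apply: K; inc. Qed.

Lemma uw_uz i : f (uw i) <> f (uz i).
Proof. by move/(@star_inj _ _ _ fproper (u i)) => K; have: uw i = uz i by apply: K; inc. Qed.

Lemma uv_vw i b : f (uv i) <> f (vw b i).
Proof. by move/(@star_inj _ _ _ fproper (v i)) => K; have: uv i = vw b i by apply: K; inc. Qed.

Lemma uw_vw i b : f (uw i) <> f (vw b i).
Proof. by move/(@star_inj _ _ _ fproper (w i)) => K; have: uw i = vw b i by apply: K; inc. Qed.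

Lemma uz_inj i j : f (uz i) = f (uz j) -> i = j.
Proof. by move/(@star_inj _ _ _ fproper z) => K; have [] : uz i = uz j by apply: K; inc. Qed.

(** Edges at [g (w i)] are images of edges at [w i], and [uv i] meets each of those in [S10], so
    properness separates the colours. This is what keeps the corners of a triangle apart. *)
Lemma w_notin_uv i : g (w i) \notin ends (f (uv i)).
Proof. by apply/negP => /star_w[[b]|] => [/uv_vw|/uv_uw]. Qed.

Lemma v_notin_uw i : g (v i) \notin ends (f (uw i)).
Proof. by apply/negP => /star_v[[b]|] => [/uw_vw|/esym/uv_uw]. Qed.

Lemma neq_vw i : g (v i) != g (w i).
Proof.
apply: contraNneq (w_notin_uv i) => <-; apply: (mem_ends_map gP); inc.
Qed.

Lemma neq_uv i : g (u i) != g (v i).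
Proof.
apply: contraNneq (v_notin_uw i) => <-; apply: (mem_ends_map gP); inc.
Qed.

Lemma neq_uw i : g (u i) != g (w i).
Proof.
apply: contraNneq (w_notin_uv i) => <-; apply: (mem_ends_map gP); inc.
Qed.

Lemma ends_vw b i : ends (f (vw b i)) = [set g (v i); g (w i)].
Proof. by apply: ends_eq (neq_vw i); apply: (mem_ends_map gP); inc. Qed.

Lemma ends_uv i : ends (f (uv i)) = [set g (u i); g (v i)].
Proof. by apply: ends_eq (neq_uv i); apply: (mem_ends_map gP); inc. Qed.

Lemma ends_uw i : ends (f (uw i)) = [set g (u i); g (w i)].
Proof. by apply: ends_eq (neq_uw i); apply: (mem_ends_map gP); inc. Qed.

Lemma u_in_uz i : g (u i) \in ends (f (uz i)).
Proof. by apply: (mem_ends_map gP); inc. Qed.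

Lemma z_in_uz i : g z \in ends (f (uz i)).
Proof. by apply: (mem_ends_map gP); inc. Qed.

(** These edges share no end in [S10], so properness does not apply; the images are told apart by
    [g (u i)], an end of only the second. *)
Lemma vw_uz i b : f (vw b i) <> f (uz i).
Proof.
move=> E; have := u_in_uz i; rewrite -E ends_vw !inE.
by rewrite (negPf (neq_uv i)) (negPf (neq_uw i)).
Qed.

Lemma v_notin_uz i : g (v i) \notin ends (f (uz i)).
Proof. by apply/negP => /star_v[[b]|] /esym => [/vw_uz|/uv_uz]. Qed.

Lemma w_notin_uz i : g (w i) \notin ends (f (uz i)).
Proof. by apply/negP => /star_w[[b]|] /esym => [/vw_uz|/uw_uz]. Qed.

(** * The triangular blocks of [H] *)

Let T i : {set vertex H} := [set g (u i); g (v i); g (w i)].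

Lemma in_T i t : (t \in T i) = [|| t == g (u i), t == g (v i) | t == g (w i)].
Proof. by rewrite !inE -orbA. Qed.

(** An edge at a corner of the block is the image of an edge at [u i], [v i] or [w i], and all of
    these but [uz i] stay inside the triangle. *)
Lemma T_closed i h p q : h <> f (uz i) ->
  p \in ends h -> q \in ends h -> p \in T i -> q \in T i.
Proof.
move=> huz ph qh; rewrite !in_T => /or3P[] /eqP pE; rewrite {}pE in ph.
- have [hE|hE|//] := star_u ph; move: qh; rewrite hE ?ends_uv ?ends_uw !inE;
    by move=> /orP[] ->; rewrite ?orbT.
- have [[b hE]|hE] := star_v ph; move: qh; rewrite hE ?ends_uv ?ends_vw !inE;
    by move=> /orP[] ->; rewrite ?orbT.
- have [[b hE]|hE] := star_w ph; move: qh; rewrite hE ?ends_uw ?ends_vw !inE;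
    by move=> /orP[] ->; rewrite ?orbT.
Qed.

(** Inside the block, [g (u i)] is the only possible end of this edge, which has two. *)
Lemma uz_leaves_T i : ~~ (ends (f (uz i)) \subset T i).
Proof.
apply/negP => /subsetP sub; have: ends (f (uz i)) \subset [set g (u i)].
  apply/subsetP => t tE; have := sub t tE; rewrite inE in_T.
  case/or3P=> /eqP tx; rewrite tx ?eqxx // in tE *.
    by rewrite (negPf (v_notin_uz i)) in tE.
  by rewrite (negPf (w_notin_uz i)) in tE.
by move/subset_leq_card; rewrite card_ends cards1.
Qed.

(* At most one of the three edges of the triangle [T i] is the edge leaving
   [T j], and the other two connect [T i]. *)
Lemma T_sub i j p : p \in T i -> p \in T j -> T i \subset T j.
Proof.
have step h x y : ends h = [set x; y] -> h <> f (uz j) -> (x \in T j) = (y \in T j).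
  move=> hE hj; apply/idP/idP; apply: (T_closed hj); by rewrite hE !inE eqxx ?orbT.
have [s1 s2] : (g (u i) \in T j) = (g (v i) \in T j) /\
               (g (u i) \in T j) = (g (w i) \in T j).
  have [uvj|/eqP uvj] := eqVneq (f (uv i)) (f (uz j)).
    have s1 : (g (u i) \in T j) = (g (w i) \in T j).
      by apply: step (ends_uw i) _; rewrite -uvj => /esym/uv_uw.
    have s2 : (g (v i) \in T j) = (g (w i) \in T j).
      by apply: step (ends_vw true i) _; rewrite -uvj => /esym/uv_vw.
    by rewrite s1 s2.
  have s1 := step _ _ _ (ends_uv i) uvj.
  have [uwj|/eqP uwj] := eqVneq (f (uw i)) (f (uz j)).
    split; rewrite // s1; apply: step (ends_vw true i) _.
    by rewrite -uwj => /esym/uw_vw.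
  by split; last exact: step (ends_uw i) uwj.
move=> pi pj; have uj : g (u i) \in T j.
  by move: pi pj; rewrite (in_T i) => /or3P[] /eqP ->; rewrite -?s1 -?s2.
apply/subsetP => t; rewrite (in_T i) => /or3P[] /eqP -> //.
  by rewrite -s1.
by rewrite -s2.
Qed.

Lemma z_notin_T i : g z \notin T i.
Proof.
rewrite in_T; apply/negP => /or3P[] /eqP zE; last 2 first.
- by have := v_notin_uz i; rewrite -zE z_in_uz.
- by have := w_notin_uz i; rewrite -zE z_in_uz.
(* In the remaining case [g z = g (u i)], the triangle edge [f (uv i)] lies at [g z]. Hence it is
   some [f (uz j)], and [T i], which contains it, lies in [T j], although that edge leaves [T j]. *)
have [j E] : exists j, f (uv i) = f (uz j).
  by apply: star_z; rewrite zE ends_uv !inE eqxx.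
have sub : ends (f (uz j)) \subset T i.
  by rewrite -E ends_uv; apply/subsetP => t; rewrite !inE => ->.
have ujTi : g (u j) \in T i by apply: (subsetP sub); apply: u_in_uz.
have := uz_leaves_T j; rewrite (subset_trans sub) //.
by apply: T_sub ujTi _; rewrite !inE eqxx.
Qed.

(** If the blocks meet, [f (uz i)] joins [g (u i)], now in [T j], to [g z] outside it. So it is the
    one edge leaving [T j], namely [f (uz j)], and properness at [z] gives [i = j]. *)
Lemma T_disjoint i j p : p \in T i -> p \in T j -> i = j.
Proof.
move=> pi pj; apply: uz_inj; apply/eqP/negPn/negP => /eqP ij.
have uj : g (u i) \in T j.
  by apply: (subsetP (T_sub pi pj)); rewrite !inE eqxx.
by have := T_closed ij (u_in_uz i) (z_in_uz i) uj; rewrite (negPf (z_notin_T j)).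
Qed.

Lemma vertex_map_S10_inj : injective g.
Proof.
have Tu i : g (u i) \in T i by rewrite !inE eqxx.
have Tv i : g (v i) \in T i by rewrite !inE eqxx ?orbT.
have Tw i : g (w i) \in T i by rewrite !inE eqxx ?orbT.
have zT i p : p \in T i -> g z <> p.
  by move=> pi zp; case/negP: (z_notin_T i); rewrite zp.
have TT i j p q : p \in T i -> q \in T j -> p = q -> i = j.
  by move=> pi qj pq; apply: T_disjoint pi _; rewrite pq.
case=> [|i|i|i] [|j|j|j] // gE.
- by case: (zT _ _ (Tu j) gE).
- by case: (zT _ _ (Tv j) gE).
- by case: (zT _ _ (Tw j) gE).
- by case: (zT _ _ (Tu i) (esym gE)).
- by rewrite (TT _ _ _ _ (Tu i) (Tu j) gE).
- have ij := TT _ _ _ _ (Tu i) (Tv j) gE; move/eqP: gE; rewrite ij.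
  by rewrite (negPf (neq_uv j)).
- have ij := TT _ _ _ _ (Tu i) (Tw j) gE; move/eqP: gE; rewrite ij.
  by rewrite (negPf (neq_uw j)).
- by case: (zT _ _ (Tv i) (esym gE)).
- have ij := TT _ _ _ _ (Tv i) (Tu j) gE; move/eqP: gE; rewrite ij eq_sym.
  by rewrite (negPf (neq_uv j)).
- by rewrite (TT _ _ _ _ (Tv i) (Tv j) gE).
- have ij := TT _ _ _ _ (Tv i) (Tw j) gE; move/eqP: gE; rewrite ij.
  by rewrite (negPf (neq_vw j)).
- by case: (zT _ _ (Tw i) (esym gE)).
- have ij := TT _ _ _ _ (Tw i) (Tu j) gE; move/eqP: gE; rewrite ij eq_sym.
  by rewrite (negPf (neq_uw j)).
- have ij := TT _ _ _ _ (Tw i) (Tv j) gE; move/eqP: gE; rewrite ij eq_sym.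
  by rewrite (negPf (neq_vw j)).
- by rewrite (TT _ _ _ _ (Tw i) (Tw j) gE).
Qed.

End Sylvester.

Theorem corollary3p7 (H : multigraph) (hconn : connected H)
  (hcol : colours H S10) : isomorphic H S10.
Proof.
(* Finite choice turns the vertex of [H] provided for each star into a function [g]. *)
case: hcol => f [fproper /fin_all_exists[g gP]].
apply: isomorphic_sym; apply: (vertex_map_inj_isomorphic fproper gP) => //.
  by apply/card_gt0P; exists S10_z.
exact: vertex_map_S10_inj fproper gP.
Qed.
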